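(* Let $\mathbf{In}_{\mathbb{R}^+}$ be the set of all endomorphisms $F$ of the monoid $(\mathbb{R}^+, \vee)$ with $\mathrm{Ker}(F) = \{1_{\mathbb{R}^+}\}$, and let $\mathbf{P}_{\mathbf{U}}$ be the set of all ultrametric-preserving functions $\mathbb{R}^+ \to \mathbb{R}^+$. Then the monoids $(\mathbf{In}_{\mathbb{R}^+}, \circ)$ and $(\mathbf{P}_{\mathbf{U}}, \circ)$, where $\circ$ is function composition, are the same.
   Context: $\mathbb{R}^+ = [0,\infty)$. The operation $\vee$ on $\mathbb{R}^+$ is $x \vee y = \max\{x,y\}$; $(\mathbb{R}^+, \vee)$ is a monoid with identity element $1_{\mathbb{R}^+} = 0$. An endomorphism of a monoid $(S,\ast,1_S)$ is a mapping $\Phi : S \to S$ with $\Phi(x \ast y) = \Phi(x) \ast \Phi(y)$ for all $x,y \in S$ and $\Phi(1_S) = 1_S$. The kernel of an endomorphism $F : S \to S$ is $\mathrm{Ker}(F) = \{ s \in S : F(s) = 1_S\}$. An ultrametric on a nonempty set $X$ is a function $d : X \times X \to \mathbb{R}^+$ such that $d(x,y)=0 \Leftrightarrow x=y$, $d(x,y)=d(y,x)$ and $d(x,y) \leqslant \max\{d(x,z), d(z,y)\}$ for all $x,y,z \in X$; then $(X,d)$ is called an ultrametric space. A function $f : \mathbb{R}^+ \to \mathbb{R}^+$ is ultrametric-preserving if $f \circ d$ (the mapping $(x,y) \mapsto f(d(x,y))$) is an ultrametric on $X$ for every ultrametric space $(X,d)$. *)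

(* Defs.v *)
From HB Require Import structures.
From mathcomp Require Import all_boot all_order all_algebra.
From mathcomp Require Import boolp classical_sets reals interval_inference.
Set Implicit Arguments.
Unset Strict Implicit.
Unset Printing Implicit Defensive.
Import Order.TTheory.
Local Open Scope classical_set_scope.
Local Open Scope ring_scope.

(* [0, +oo[, as an alias of {nonneg R} so that the max monoid structure below
   is not attached to {nonneg R} itself. *)
Definition nngreal (R : realType) : Type := {nonneg R}.

HB.instance Definition _ (R : realType) := Order.Total.on (nngreal R).

Definition nngreal0 (R : realType) : nngreal R := 0%:nng.

Definition nngreal_max (R : realType) (x y : nngreal R) : nngreal R :=
  Order.max x y.

Fact nngreal_maxA (R : realType) : associative (@nngreal_max R).
Proof. exact: maxA. Qed.

Fact nngreal_max0x (R : realType) : left_id (nngreal0 R) (@nngreal_max R).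
Proof. by move=> x; apply/max_idPr; exact: (ge0 x). Qed.

Fact nngreal_maxx0 (R : realType) : right_id (nngreal0 R) (@nngreal_max R).
Proof. by move=> x; rewrite /nngreal_max maxC; exact: nngreal_max0x. Qed.

(* On nngreal R, the monoid product ( * )%g is max and 1%g is 0. *)
HB.instance Definition _ (R : realType) :=
  isMonoid.Build (nngreal R)
    (@nngreal_maxA R) (@nngreal_max0x R) (@nngreal_maxx0 R).

(* Functions T -> T; the product ( * )%g is composition and 1%g is id.
   The alias keeps this monoid structure off plain function types. *)
Definition selfmap (T : Type) : Type := T -> T.

HB.instance Definition _ (T : Type) := gen_eqMixin (selfmap T).
HB.instance Definition _ (T : Type) := gen_choiceMixin (selfmap T).

Definition selfmap_id (T : Type) : selfmap T := id.

Definition selfmap_comp (T : Type) (f g : selfmap T) : selfmap T := f \o g.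

Fact selfmap_compA (T : Type) : associative (@selfmap_comp T).
Proof. by []. Qed.

Fact selfmap_id_comp (T : Type) : left_id (@selfmap_id T) (@selfmap_comp T).
Proof. by []. Qed.

Fact selfmap_comp_id (T : Type) : right_id (@selfmap_id T) (@selfmap_comp T).
Proof. by []. Qed.

HB.instance Definition _ (T : Type) :=
  isMonoid.Build (selfmap T)
    (@selfmap_compA T) (@selfmap_id_comp T) (@selfmap_comp_id T).

(* monoid_morphism is the notion of boot/monoid, not that of ssralg. *)
Definition is_endomorphism (S : monoidType) (F : S -> S) : Prop :=
  monoid.monoid_morphism F.

Definition Ker (S : monoidType) (F : S -> S) : set S := [set s | F s = 1%g].

Definition In_endo (S : monoidType) : set (selfmap S) :=
  [set F | is_endomorphism F /\ Ker F = [set 1%g]].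

Definition is_ultrametric (R : realType) (X : Type)
    (d : X -> X -> nngreal R) : Prop :=
  [/\ forall x y, d x y = nngreal0 R <-> x = y,
      forall x y, d x y = d y x &
      forall x y z, d x y <= Order.max (d x z) (d z y)].

Definition ultrametric_preserving (R : realType)
    (f : nngreal R -> nngreal R) : Prop :=
  forall (X : Type) (d : X -> X -> nngreal R), inhabited X ->
    is_ultrametric d -> is_ultrametric (fun x y => f (d x y)).

Definition P_U (R : realType) : set (selfmap (nngreal R)) :=
  [set f | ultrametric_preserving f].

Arguments In_endo : clear implicits.
Arguments P_U : clear implicits.

(* Main.v *)
(** The maps [x |-> f x] preserving ultrametrics are the nondecreasing [f] with
    [f x = 0] only at [x = 0].  To see that they must be, transport by [f] the
    single ultrametric [max x y] (for [x <> y]) on [0, +oo[ itself: the distance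
    from [0] to [x] is [x], and for [0 < a < b] the points [0, a, b] form an
    isosceles triangle with base [a] and legs [b], so the strong triangle
    inequality for the image reads [f a <= f b].  On a chain, preserving max is
    the same as being nondecreasing. *)
Require Import Defs.
From HB Require Import structures.
From mathcomp Require Import all_boot all_order all_algebra.
From mathcomp Require Import boolp classical_sets reals interval_inference.
Set Implicit Arguments.
Unset Strict Implicit.
Unset Printing Implicit Defensive.
Import Order.TTheory.
Local Open Scope classical_set_scope.
Local Open Scope ring_scope.

Section NonnegativeReals.
Variable R : realType.
Implicit Types (x y z : nngreal R) (f : nngreal R -> nngreal R).

Lemma nngreal_ge0 x : nngreal0 R <= x.
Proof. exact: (ge0 x). Qed.

Lemma nngreal_le0 x : x <= nngreal0 R -> x = nngreal0 R.
Proof. by move=> x0; apply/le_anti; rewrite x0 nngreal_ge0. Qed.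

Definition max_dist x y : nngreal R :=
  if x == y then nngreal0 R else Order.max x y.

Lemma max_dist0l x : max_dist (nngreal0 R) x = x.
Proof.
by rewrite /max_dist; case: eqVneq => // _; apply/max_idPr/nngreal_ge0.
Qed.

Lemma max_dist_lt x y : x < y -> max_dist y x = y.
Proof. by move=> xy; rewrite /max_dist gt_eqF// max_l// ltW. Qed.

Lemma max_dist_ultrametric : is_ultrametric max_dist.
Proof.
split=> [x y|x y|x y z].
- rewrite /max_dist; case: (eqVneq x y) => [//|/eqP xy]; split=> // xy0.
  case: xy.
  have /nngreal_le0 -> : x <= nngreal0 R by rewrite -xy0 le_max lexx.
  by apply/esym/nngreal_le0; rewrite -xy0 le_max lexx orbT.
- by rewrite /max_dist eq_sym maxC.
- rewrite /max_dist; case: (eqVneq x y) => [_|xy]; first exact: nngreal_ge0.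
  (* If [z] is [x] or [y], one term on the right equals the left side; otherwise the right side is
     the maximum of [x], [y] and [z]. *)
  case: (eqVneq x z) => [<-|_].
    by rewrite (negPf xy) le_max lexx orbT.
  case: (eqVneq z y) => [->|_]; first by rewrite le_max lexx.
  by rewrite ge_max !le_max !lexx !orbT.
Qed.

Definition nondecreasing_pos f :=
  [/\ {homo f : x y / x <= y},
      f (nngreal0 R) = nngreal0 R &
      forall x, f x = nngreal0 R -> x = nngreal0 R].

Lemma ultrametric_preservingP f :
  ultrametric_preserving f <-> nondecreasing_pos f.
Proof.
split=> [fU|[f_homo f0 f_eq0] X d _ [d_eq0 d_sym d_ultra]].
- have [fd_eq0 _ fd_ultra] := fU _ _ (inhabits (nngreal0 R)) max_dist_ultrametric.
  split=> [x y||x fx0].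
  + rewrite le_eqVlt => /predU1P[-> //|xy].
    by have := fd_ultra (nngreal0 R) x y; rewrite !max_dist0l max_dist_lt// maxxx.
  + by rewrite -{1}(max_dist0l (nngreal0 R)); apply/fd_eq0.
  + by apply/esym/fd_eq0; rewrite max_dist0l.
- split=> [x y|x y|x y z].
  + split=> [/f_eq0/d_eq0 //|/d_eq0 ->]; exact: f0.
  + by rewrite d_sym.
  (* In a chain, one of the two distances alone bounds [d x y], and [f] keeps that bound. *)
  + have := d_ultra x y z; rewrite !le_max => /orP[] /f_homo -> //.
    by rewrite orbT.
Qed.

Lemma In_endoP f : In_endo (nngreal R) f <-> nondecreasing_pos f.
Proof.
split=> [[[f0 fM] kerf]|[f_homo f0 f_eq0]].
- split=> [x y /max_idPr xy||x fx0]; first 2 last.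
  + by have : Ker f x by []; rewrite kerf.
  (* Here [x <= y] is read as [max x y = y], an equation that [f] carries over. *)
  + by apply/max_idPr; rewrite -[RHS](congr1 f xy); apply/esym/fM.
  + exact: f0.
- split.
  + split=> [|x y]; first exact: f0.
    change (f (Order.max x y) = Order.max (f x) (f y)).
    have [xy|/ltW yx] := leP x y.
      by rewrite max_r ?f_homo.
    by rewrite max_l ?f_homo.
  + by apply/seteqP; split=> x => [/f_eq0|->].
Qed.

Lemma In_endo_eq_P_U : In_endo (nngreal R) = P_U R.
Proof.
apply/seteqP; split=> f; first by move/In_endoP/ultrametric_preservingP.
by move/ultrametric_preservingP/In_endoP.
Qed.

Lemma P_U_monoid_closed : monoid_closed (mem (P_U R)).
Proof.
split=> [|f g]; first by apply/mem_set => X d.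
(* [g] turns [d] into another ultrametric on [X], to which [f] applies. *)
move=> /set_mem fU /set_mem gU; apply/mem_set => X d X0 /(gU _ _ X0).
exact: fU.
Qed.

End NonnegativeReals.

Theorem theorem3p4 (R : realType) :
  [/\ monoid_closed (mem (In_endo (nngreal R))),
      monoid_closed (mem (P_U R)) &
      In_endo (nngreal R) = P_U R].
Proof.
(* The endomorphisms inherit closure from [P_U] through the equality. *)
by rewrite In_endo_eq_P_U; split=> //; exact: P_U_monoid_closed.
Qed.
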